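(* Let $\mathcal{C}$ be a $(v_r,b_k)$ configuration with $r>2$ (and $k\ge 2$, $v\ge 4$, $b\ge 4$). Then for every field $\mathbf F$, the well-covered dimension of the Levi graph of $\mathcal{C}$ is $0$, i.e. $wcdim(Levi_{\mathcal{C}},\mathbf F)=0$.
   Context: A configuration is an incidence structure consisting of a set of points and a set of lines together with an incidence relation between points and lines, such that any two distinct points are incident with at most one common line and any two distinct lines are incident with at most one common point. A $(v_r,b_k)$ configuration is a configuration with exactly $v\ge 4$ points and exactly $b\ge 4$ lines, in which every line is incident with exactly $k\ge 2$ points and every point is incident with exactly $r\ge 2$ lines. The Levi graph $Levi_{\mathcal{C}}$ of a configuration $\mathcal{C}$ is the simple bipartite graph whose vertex set is the disjoint union of the points and the lines of $\mathcal{C}$, with a point-vertex $P$ adjacent to a line-vertex $\ell$ iff $P$ is incident with $\ell$, and no other edges. For a graph $G$ and a field $\mathbf F$, a weighting $f:V(G)\to\mathbf F$ is well-covered if $\sum_{x\in M} f(x)$ takes the same value for every maximal independent set $M$ of $G$; the well-covered weightings form an $\mathbf F$-vector space, the well-covered space, whose dimension is the well-covered dimension $wcdim(G,\mathbf F)$. *)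

(* Defs.v *)
From HB Require Import structures.
From mathcomp Require Import all_boot all_order all_algebra.

Set Implicit Arguments.
Unset Strict Implicit.
Unset Printing Implicit Defensive.

Import GRing.Theory.
Local Open Scope ring_scope.

Record sgraph := SGraph {
  vertex :> finType;
  adj : rel vertex;
  adj_sym : symmetric adj;
  adj_irr : irreflexive adj }.

Definition independent (G : sgraph) (M : {set G}) : bool :=
  [forall x in M, forall y in M, ~~ adj x y].

Definition max_independent (G : sgraph) (M : {set G}) : bool :=
  maxset (@independent G) M.

Section WellCovered.

Variables (F : fieldType) (G : sgraph).

(* F^o is F regarded as a vector space over itself; with it, the functions
   from the vertices to F form an F-vector space. *)
Definition weighting := {ffun G -> F^o}.

Definition well_covered (f : weighting) : Prop :=
  forall M N : {set G}, max_independent M -> max_independent N ->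
    \sum_(x in M) f x = \sum_(x in N) f x.

Definition weight_diff (M N : {set G}) (f : weighting) : F^o :=
  \sum_(x in M) f x - \sum_(x in N) f x.

Fact weight_diff_linear (M N : {set G}) : linear (weight_diff M N).
Proof.
move=> a f g; rewrite /weight_diff scalerBr !scaler_sumr addrACA -opprD.
rewrite -!big_split /=.
by congr (_ - _); apply: eq_bigr => x _; rewrite !ffunE.
Qed.

HB.instance Definition _ (M N : {set G}) :=
  GRing.isLinear.Build F weighting F^o *:%R (weight_diff M N)
    (weight_diff_linear M N).

(* The subspace whose elements are exactly the well-covered weightings, see
   wc_spaceP. *)
Definition wc_space : {vspace weighting} :=
  (\bigcap_(MN : {set G} * {set G} |
              max_independent MN.1 && max_independent MN.2)
     lker (linfun (weight_diff MN.1 MN.2)))%VS.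

Lemma wc_spaceP (f : weighting) : reflect (well_covered f) (f \in wc_space).
Proof.
apply: (iffP idP) => [/subv_bigcapP fW M N maxM maxN | fW].
  have := fW (M, N); rewrite /= maxM maxN => /(_ isT).
  rewrite -memvE memv_ker lfunE /= => /eqP; rewrite /weight_diff => /eqP.
  by rewrite subr_eq0 => /eqP.
apply/subv_bigcapP => -[M N] /= /andP[maxM maxN].
by rewrite -memvE memv_ker lfunE /= /weight_diff (fW M N) // subrr.
Qed.

End WellCovered.

Definition wcdim (G : sgraph) (F : fieldType) : nat := \dim (wc_space F G).

Record configuration := Configuration {
  point : finType;
  line : finType;
  inc : point -> line -> bool;
  common_line_uniq : forall (p q : point) (l m : line), p != q ->
    inc p l -> inc q l -> inc p m -> inc q m -> l = m;
  common_point_uniq : forall (l m : line) (p q : point), l != m ->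
    inc p l -> inc p m -> inc q l -> inc q m -> p = q }.

Definition vrbk_configuration (C : configuration) (v r b k : nat) : Prop :=
  [/\ [/\ (4 <= v)%N, (4 <= b)%N, (2 <= r)%N & (2 <= k)%N],
      #|point C| = v /\ #|line C| = b,
      forall l : line C, #|[set p | inc p l]| = k &
      forall p : point C, #|[set l | inc p l]| = r].

Section Levi.

Variable C : configuration.

Definition levi_adj : rel (point C + line C) := fun x y =>
  match x, y with
  | inl p, inr l | inr l, inl p => inc p l
  | _, _ => false
  end.

Fact levi_adj_sym : symmetric levi_adj.
Proof. by case=> [p|l] [q|m]. Qed.

Fact levi_adj_irr : irreflexive levi_adj.
Proof. by case. Qed.

Definition levi_graph : sgraph := SGraph levi_adj_sym levi_adj_irr.

End Levi.

(* Main.v *)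
Require Import Defs.
From mathcomp Require Import all_boot all_order all_algebra.

(** For a set [S] of fewer than [r] points, [S] together with all lines missing
    [S] is a maximal independent set: a point outside [S] lies on [r] lines, and
    at most [#|S|] of these meet [S].  Comparing with the case [S = set0], the
    weight of [S] is the total weight of the lines meeting [S].  As [r > 2], this
    applies to [{p}], [{q}] and [{p, q}] for two points [p], [q] of a line [n];
    inclusion-exclusion then forces [f n = 0].  So all lines, and hence all
    points, have weight 0. *)

Set Implicit Arguments.
Unset Strict Implicit.

Import GRing.Theory.

Section LeviWeights.

Variable C : configuration.
Implicit Types (S : {set point C}) (p q : point C) (l : line C).

Definition meets S l : bool := [exists p in S, inc p l].

Lemma meetsP S l : reflect (exists2 p, p \in S & inc p l) (meets S l).
Proof. exact: exists_inP. Qed.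

Definition points_and_missing_lines S : {set levi_graph C} :=
  [set x : point C + line C |
     match x with inl p => p \in S | inr l => ~~ meets S l end].

(** Picking on each such line a point of [S] is injective: two lines through [p] with the same
    chosen point share two distinct points, as [p] is outside [S]. *)
Lemma card_lines_meeting S p :
  p \notin S -> #|[set l | inc p l & meets S l]| <= #|S|.
Proof.
move=> pS; pose h l := odflt p [pick q in S | inc q l].
have hP l : meets S l -> h l \in S /\ inc (h l) l.
  case/meetsP=> q qS ql; rewrite /h.
  by case: pickP => [s /andP[]|/(_ q)] //=; rewrite qS ql.
rewrite -(card_in_imset (f := h)) => [|l m].
  by apply/subset_leq_card/subsetP => _ /imsetP[l + ->];
     rewrite inE => /andP[_ /hP[]].
rewrite !inE => /andP[pl /hP[hS hl]] /andP[pm /hP[_ hm]] hlm.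
apply: (@common_line_uniq C p (h l)) => //; last by rewrite hlm.
by apply: contraNneq pS => ->.
Qed.

Lemma max_independent_points_and_missing_lines S :
    (forall p, #|S| < #|[set l | inc p l]|) ->
  max_independent (points_and_missing_lines S).
Proof.
move=> ltS; apply/maxsetP; split.
  apply/forall_inP => -[p|l]; rewrite inE => xS;
    apply/forall_inP => -[q|m]; rewrite inE => yS //=.
    by apply: contra yS => pm; apply/meetsP; exists p.
  by apply: contra xS => ql; apply/meetsP; exists q.
move=> B /forall_inP indB sSB; apply/eqP; rewrite eqEsubset sSB andbT.
apply/subsetP => -[p|l] xB; rewrite inE; last first.
  apply/negP => /meetsP[p pS pl].
  have pB : inl p \in B by apply: (subsetP sSB); rewrite inE.
  by move: (indB _ pB) => /forall_inP/(_ _ xB); rewrite /= pl.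
(* Lines missing [S] already lie in [B], so independence forces every line through [p] to meet [S];
   there are more than [#|S|] of these. *)
apply/negPn/negP => /card_lines_meeting; rewrite leqNgt => /negP; apply.
apply: leq_trans (ltS p) _; apply/subset_leq_card/subsetP => l.
rewrite !inE => pl; rewrite pl; apply: contraT => lS.
have lB : inr l \in B by apply: (subsetP sSB); rewrite inE.
by move: (indB _ xB) => /forall_inP/(_ _ lB); rewrite /= pl.
Qed.

Variables (F : fieldType) (f : weighting F (levi_graph C)).
Hypothesis wf : well_covered f.

Local Open Scope ring_scope.

Lemma sum_points_eq_sum_meeting S :
    (forall p, #|S| < #|[set l | inc p l]|)%N ->
  \sum_(p in S) f (inl p) = \sum_(l | meets S l) f (inr l).
Proof.
move=> ltS.
have lt0 p : (#|@set0 (point C)| < #|[set l | inc p l]|)%N.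
  by rewrite cards0; apply: leq_ltn_trans (ltS p).
have := wf (max_independent_points_and_missing_lines ltS)
           (max_independent_points_and_missing_lines lt0).
have sumE T : \sum_(x in points_and_missing_lines T) f x =
    \sum_(p in T) f (inl p) + \sum_(l | ~~ meets T l) f (inr l).
  rewrite big_sumType /=.
  by congr (_ + _); apply: eq_bigl => x; rewrite inE.
rewrite !sumE big_set0 add0r.
have -> : \sum_(l | ~~ meets set0 l) f (inr l) = \sum_l f (inr l).
  by apply: eq_bigl => l; apply/meetsP => -[p]; rewrite inE.
(* The set for [set0] consists of all lines; cancel the lines missing [S] on both sides. *)
by rewrite [RHS](bigID (meets S)) /= => /addIr.
Qed.

Hypothesis r_gt2 : forall p, (2 < #|[set l | inc p l]|)%N.

Lemma point_weight p : f (inl p) = \sum_(l | inc p l) f (inr l).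
Proof.
have := @sum_points_eq_sum_meeting [set p].
rewrite big_set1 => -> => [|q]; last by rewrite cards1 ltnW.
by apply: eq_bigl => l; apply/meetsP/idP => [[q /set1P->]|] //;
   exists p; rewrite ?set11.
Qed.

Lemma line_weight p q l :
  p != q -> inc p l -> inc q l -> f (inr l) = 0.
Proof.
move=> pq pl ql.
have lt2 (s : point C) : (#|[set p; q]| < #|[set l | inc s l]|)%N.
  by rewrite cards2 pq; apply: r_gt2.
have := sum_points_eq_sum_meeting lt2.
rewrite big_setU1 ?inE //= big_set1 !point_weight.
(* Both sides are split by incidence with [p]. The right side becomes the lines through [p] plus
   those through [q] only; the left side has in addition the lines through both. *)
rewrite [RHS](bigID (inc p)) (bigID (inc p) (inc q)) /=.
rewrite (eq_bigl (inc p) (P1 := fun m => meets _ m && inc p m)); last first.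
  move=> m; rewrite andb_idl // => pm; apply/meetsP.
  by exists p; rewrite ?set21.
rewrite (eq_bigl (fun m => inc q m && ~~ inc p m)
           (P1 := fun m => meets _ m && ~~ inc p m)); last first.
  move=> m; apply/andP/andP => -[qm pm]; split=> //.
    by case/meetsP: qm pm => s /set2P[]-> // ->.
  by apply/meetsP; exists q; rewrite ?set22.
(* Since [p != q], the surplus on the left is the single term [f (inr l)]. *)
rewrite (big_pred1 l (P := fun m => inc q m && inc p m)) => [|m]; last first.
  apply/andP/eqP => [[qm pm]|->] //.
  exact: common_line_uniq pq pm qm pl ql.
by rewrite addrCA => /(canRL (addrK _)); rewrite subrr.
Qed.

End LeviWeights.

Theorem theorem1p7 (C : configuration) (v r b k : nat)
    (hC : vrbk_configuration C v r b k) (hr : 2 < r) (F : fieldType) :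
  wcdim (levi_graph C) F = 0.
Proof.
case: hC => -[_ _ _ k_gt1] _ card_points card_lines.
apply/eqP; rewrite dimv_eq0 -subv0; apply/subvP => f /wc_spaceP wf.
have r_gt2 p : 2 < #|[set l : line C | inc p l]| by rewrite card_lines.
have f_line l : f (inr l) = 0%R.
  (* Here [k >= 2] supplies the two distinct points on [l]. *)
  have /card_gt1P[p [q [+ + pq]]] : 1 < #|[set p : point C | inc p l]|.
    by rewrite card_points.
  by rewrite !inE => pl ql; apply: line_weight wf r_gt2 _ _ _ pq pl ql.
rewrite memv0; apply/eqP/ffunP => -[p|l]; rewrite ffunE //.
by rewrite point_weight // big1.
Qed.
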